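(* The formula $$\{F,G\}:=\mathrm{i}\sum_{(\alpha^{(1)},\beta^{(1)}),(\alpha^{(2)},\beta^{(2)})\in\mathcal{M}}F_{\alpha^{(1)},\beta^{(1)}}G_{\alpha^{(2)},\beta^{(2)}}\sum_j\big(\alpha^{(1)}_j\beta^{(2)}_j-\beta^{(1)}_j\alpha^{(2)}_j\big)u^{\alpha^{(1)}+\alpha^{(2)}-\mathbf e_j}\bar u^{\beta^{(1)}+\beta^{(2)}-\mathbf e_j}$$ is well defined for $F,G\in\mathcal F$ (each coefficient of a monomial $u^\alpha\bar u^\beta$ on the right-hand side is a finite sum, and the result lies in $\mathcal F$). It endows $\mathcal{F}$ with a Poisson algebra structure, which is a filtered Lie algebra with respect to the subspaces $\mathcal{F}^{\ge d}$, $d\in\mathbb N$, i.e. $\{\mathcal F^{\ge d_1},\mathcal F^{\ge d_2}\}\subset\mathcal F^{\ge d_1+d_2}$.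
   Context: $\mathbb{N}=\{0,1,2,\dots\}$. $\mathbb{N}^{\mathbb{Z}}_f$ denotes the finitely supported sequences of non-negative integers indexed by $\mathbb{Z}$; $|k|=\sum_j|k_j|$; $\mathbf e_j$ is the $j$-th standard basis vector; $u^\alpha=\prod_j u_j^{\alpha_j}$. $\pi(\alpha,\beta):=\sum_jj(\alpha_j-\beta_j)$ and $\mathcal{M}:=\{(\alpha,\beta)\in\mathbb{N}^{\mathbb{Z}}_f\times\mathbb{N}^{\mathbb{Z}}_f:\pi(\alpha,\beta)=0\}$. $\mathcal{F}$ is the (real vector) space of formal power series $H=\sum_{\alpha,\beta\in\mathbb{N}^{\mathbb{Z}}_f}H_{\alpha,\beta}u^\alpha\bar u^\beta$ (with $H_{\alpha,\beta}\in\mathbb C$, $u=(u_j)_{j\in\mathbb Z}$) such that $H_{0,0}=H_{\mathbf e_0,0}=H_{0,\mathbf e_0}=0$; $H_{\alpha,\beta}=\overline{H_{\beta,\alpha}}$ for all $\alpha,\beta$; and $H_{\alpha,\beta}=0$ whenever $\pi(\alpha,\beta)\neq0$. $\mathcal{F}^{\ge d}$ is the set of $H\in\mathcal F$ with $H_{\alpha,\beta}=0$ unless $|\alpha|+|\beta|\ge d+2$. Here ''Poisson algebra'' is in the non-unital sense: the commutative product is the product of formal power series, and the bracket is a Lie bracket satisfying the Leibniz rule. Terms in the formula with a vanishing factor $\alpha^{(1)}_j\beta^{(2)}_j-\beta^{(1)}_j\alpha^{(2)}_j$ are understood as zero. *)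

(* Defs.v *)
From HB Require Import structures.
From mathcomp Require Import all_boot all_order all_algebra.
From mathcomp Require Import finmap complex.
From mathcomp Require Import monalg.
From mathcomp Require Import boolp classical_sets functions cardinality fsbigop.
From mathcomp Require Import reals.

Set Implicit Arguments.
Unset Strict Implicit.
Unset Printing Implicit Defensive.

Import Order.TTheory GRing.Theory Num.Theory.
Local Open Scope classical_set_scope.
Local Open Scope ring_scope.

(* A finitely supported sequence of naturals indexed by the integers is a
   commutative monomial in {cmonom int}. The monomial structure is written
   multiplicatively: mmul is the sum of multi-indices, mone is 0,
   ucm j is the basis vector e_j and mdeg is the length |k|. *)

(* (alpha, beta) stands for the monomial u^alpha ubar^beta. *)
Notation bi_index := ({cmonom int} * {cmonom int})%type.

(* Here and below, the sums over classical sets are finite-support sums. *)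
Definition momentum (m : bi_index) : int :=
  \sum_(j \in [set: int]) j * ((m.1 j)%:Z - (m.2 j)%:Z).

Definition momentum_zero : set bi_index := [set m | momentum m = 0].

(* Rcomplex R is R[i] seen as a real vector space, so that formal series with
   complex coefficients form an lmodType R. *)
Notation fseries R := (bi_index -> Rcomplex R).

Section Series.
Variable R : realType.
Implicit Types (F G H : fseries R) (m : bi_index).

Definition in_calF H : Prop :=
  [/\ [/\ H (mone, mone) = 0,
          H (@ucm int 0, mone) = 0 &
          H (mone, @ucm int 0) = 0],
      forall alpha beta, H (alpha, beta) = conjc (H (beta, alpha)) &
      forall m, momentum m <> 0 -> H m = 0].

Definition calF_pred : {pred fseries R} := [pred H | `[< in_calF H >]].

Lemma calF_submod_closed : submod_closed calF_pred.
Proof.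
split=> [|a F G].
  apply/asboolP; split=> //= alpha beta.
  exact: esym (raddf0 (@conjc R)).
move=> /asboolP[[F0 F1 F2] Fc Fm] /asboolP[[G0 G1 G2] Gc Gm].
have E m : (a *: F + G) m = a *: F m + G m by [].
apply/asboolP; split=> [|alpha beta|m mP].
- by rewrite !E F0 F1 F2 G0 G1 G2 scaler0 addr0.
- by rewrite !E Fc Gc; case: (F _) => ? ?; case: (G _) => ? ?; congr Complex;
    rewrite /= mulrN opprD.
- by rewrite E Fm // Gm // scaler0 addr0.
Qed.

HB.instance Definition _ :=
  GRing.isSubmodClosed.Build R (fseries R) calF_pred calF_submod_closed.

Record calF := CalF { calF_val :> fseries R; calF_valP : calF_val \in calF_pred }.

HB.instance Definition _ := [isSub for calF_val].
HB.instance Definition _ := [Choice of calF by <:].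
HB.instance Definition _ := [SubChoice_isSubLmodule of calF by <:].

Definition calF_ge (d : nat) : set calF :=
  [set H : calF | forall alpha beta,
     (mdeg alpha + mdeg beta < d + 2)%N -> H (alpha, beta) = 0].

Definition series_mul F G : fseries R := fun m =>
  \sum_(p \in [set p : bi_index * bi_index |
                 (mmul p.1.1 p.2.1, mmul p.1.2 p.2.2) = m]) F p.1 * G p.2.

Definition bracket_factor (m1 m2 : bi_index) (j : int) : int :=
  (m1.1 j)%:Z * (m2.2 j)%:Z - (m1.2 j)%:Z * (m2.1 j)%:Z.

(* The indices (m1, m2, j) of the terms of the bracket formula that contribute
   to the monomial m. The equation alpha1 + alpha2 - e_j = alpha of integer
   sequences is written alpha1 + alpha2 = alpha + e_j to avoid truncated
   subtraction. *)
Definition bracket_terms m : set (bi_index * bi_index * int) :=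
  [set t | let: (m1, m2, j) := t in
     [/\ momentum_zero m1, momentum_zero m2, bracket_factor m1 m2 j <> 0,
         mmul m1.1 m2.1 = mmul m.1 (ucm j) &
         mmul m1.2 m2.2 = mmul m.2 (ucm j)]].

Definition series_bracket F G : fseries R := fun m =>
  ('i%C : Rcomplex R) * \sum_(t \in bracket_terms m)
    F t.1.1 * G t.1.2 * (bracket_factor t.1.1 t.1.2 t.2)%:~R.

End Series.

Section Algebras.
Variables (R : pzRingType) (V : lmodType R).
Implicit Types mul br : V -> V -> V.

Definition bilinear_op mul : Prop :=
  (forall x, linear (mul x)) /\ (forall y, linear (mul^~ y)).

Definition is_lie_bracket br : Prop :=
  [/\ bilinear_op br,
      forall x, br x x = 0 &
      forall x y z, br x (br y z) + br y (br z x) + br z (br x y) = 0].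

Definition is_poisson_algebra mul br : Prop :=
  [/\ bilinear_op mul, associative mul, commutative mul,
      is_lie_bracket br &
      forall x y z, br x (mul y z) = mul (br x y) z + mul y (br x z)].

Definition is_filtered_lie_algebra br (V_ : nat -> set V) : Prop :=
  [/\ is_lie_bracket br,
      forall d, submod_closed (mem (V_ d)),
      V_ 0%N = setT,
      forall d, V_ d.+1 `<=` V_ d &
      forall d1 d2 x y, V_ d1 x -> V_ d2 y -> V_ (d1 + d2)%N (br x y)].

End Algebras.

(* Main.v *)
(* Each coefficient of a product or a bracket is a finite sum, so both operations
   are given by kernels: [op F G m] is the sum of [F a * G b * K a b m] over a
   finite set of indices depending only on [m]. An identity between nested
   operations then has to be checked only on the composed kernels, that is, on
   monomials. Finiteness of the bracket uses the momentum: a variable [u_j] that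
   does not occur in [m] is determined by the momentum of the remaining factor, a
   divisor of [m]. On monomials, the Jacobi identity is a double sum over pairs
   [(k, j)] whose cyclic symmetrization is antisymmetric under [k <-> j]. *)
Require Import Defs.
From mathcomp Require Import all_boot all_order all_algebra.
From mathcomp Require Import finmap complex monalg ring zify.
From mathcomp Require Import boolp classical_sets functions cardinality fsbigop.
From mathcomp Require Import reals.

Set Implicit Arguments.
Unset Strict Implicit.
Unset Printing Implicit Defensive.

Import Order.TTheory GRing.Theory Num.Theory.
Local Open Scope classical_set_scope.
Local Open Scope ring_scope.

(** * Operations given by kernels, and nested expressions *)

Section Kernels.
Variables (T : choiceType) (C : idomainType).
Implicit Types (op : (T -> C) -> (T -> C) -> T -> C) (K : T -> T -> T -> C).
Implicit Types (F G H : T -> C) (Phi : (T -> C) -> (T -> C) -> (T -> C) -> C).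
Implicit Types (k : T -> T -> T -> C) (S : {fset T}).

(** The set [S] is fixed before [F] and [G] and captures every nonzero kernel entry, so it can be
    enlarged freely and shared by several series. *)
Definition has_kernel op K : Prop := forall m, exists S,
  (forall a b, ~~ ((a \in S) && (b \in S)) -> K a b m = 0) /\
  forall F G, op F G m = \sum_(a <- S) \sum_(b <- S) F a * G b * K a b m.

Definition kcomp K1 K2 a b c m : C :=
  \sum_(q \in [set: T]) K1 a q m * K2 b c q.

(** Quantifying over all [S] above [S0] lets two expressions be expanded over one common set. *)
Definition trilinear_kernel Phi k : Prop := exists S0, forall S,
  (S0 `<=` S)%fset -> forall F G H,
  Phi F G H = \sum_(a <- S) \sum_(b <- S) \sum_(c <- S) F a * G b * H c * k a b c.

Lemma has_kernel_sub op K m : has_kernel op K -> exists S0, forall S,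
  (S0 `<=` S)%fset -> forall F G,
  op F G m = \sum_(a <- S) \sum_(b <- S) F a * G b * K a b m.
Proof.
move=> /(_ m)[S0 [K0 KE]]; exists S0 => S S0S F G; rewrite KE.
rewrite -(big_fset_incl _ S0S) => [|a _ aS0]; last first.
  by apply: big1 => b _; rewrite K0 ?mulr0 // (negbTE aS0).
apply: eq_bigr => a _; apply: big_fset_incl => // b _ bS0.
by rewrite K0 ?mulr0 // (negbTE bS0) andbF.
Qed.

Lemma has_kernelC op K e : has_kernel op K ->
    (forall a b m, K a b m = e * K b a m) ->
  forall F G m, op F G m = e * op G F m.
Proof.
move=> /has_kernel_sub hK KC F G m; have [S0 {}hK] := hK m.
rewrite !(hK _ (fsubset_refl _)) exchange_big mulr_sumr /=.
apply: eq_bigr => a _; rewrite mulr_sumr; apply: eq_bigr => b _.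
by rewrite KC; ring.
Qed.

(** Only the finitely many [q] in [S1] enter at [m], and the coefficient of [op2 G H] at such a [q]
    needs a finite set [f q]; the union of these sets carries the whole expansion. *)
Lemma kernel_comp op1 op2 K1 K2 m : has_kernel op1 K1 -> has_kernel op2 K2 ->
  trilinear_kernel (fun F G H => op1 F (op2 G H) m)
    (fun a b c => kcomp K1 K2 a b c m).
Proof.
move=> h1 h2; have [S1 [K10 E1]] := h1 m.
have /choice[f fP] q : exists S0, forall S, (S0 `<=` S)%fset -> forall F G,
    op2 F G q = \sum_(a <- S) \sum_(b <- S) F a * G b * K2 a b q.
  exact: has_kernel_sub.
exists (S1 `|` \bigcup_(q <- S1) f q)%fset => S SS F G H; rewrite E1.
have S1S : (S1 `<=` S)%fset by apply: fsubset_trans SS; apply: fsubsetUl.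
rewrite (big_fset_incl _ S1S) => [|a _ aS1]; last first.
  by apply: big1 => b _; rewrite K10 ?mulr0 // (negbTE aS1).
apply: eq_bigr => a _ /=.
under [RHS]eq_bigr => b _.
  under eq_bigr => c _.
    rewrite /kcomp (@fsbigTE _ _ _ _ S1); last first.
      by move=> q qS; rewrite K10 ?mul0r // (negbTE qS) andbF.
    rewrite mulr_sumr; over.
  rewrite exchange_big; over.
rewrite exchange_big; apply: eq_big_seq => q qS1 /=.
rewrite (fP q S); last first.
  apply: fsubset_trans SS; apply: fsubsetU; apply/orP; right.
  exact: bigfcup_sup.
rewrite mulr_sumr mulr_suml; apply: eq_bigr => b _.
by rewrite mulr_sumr mulr_suml; apply: eq_bigr => c _; ring.
Qed.

Lemma trilinear_kernel_rot Phi k : trilinear_kernel Phi k ->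
  trilinear_kernel (fun F G H => Phi G H F) (fun a b c => k b c a).
Proof.
move=> [S0 PhiE]; exists S0 => S SS F G H; rewrite (PhiE S) //.
under eq_bigr do rewrite exchange_big.
rewrite exchange_big; apply: eq_bigr => a _; apply: eq_bigr => b _.
by apply: eq_bigr => c _ /=; ring.
Qed.

Lemma trilinear_kernel_swap Phi k : trilinear_kernel Phi k ->
  trilinear_kernel (fun F G H => Phi G F H) (fun a b c => k b a c).
Proof.
move=> [S0 PhiE]; exists S0 => S SS F G H; rewrite (PhiE S) //.
rewrite exchange_big; apply: eq_bigr => a _; apply: eq_bigr => b _.
by apply: eq_bigr => c _ /=; ring.
Qed.

Lemma trilinear_kernelD Phi Psi k l :
  trilinear_kernel Phi k -> trilinear_kernel Psi l ->
  trilinear_kernel (fun F G H => Phi F G H + Psi F G H)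
    (fun a b c => k a b c + l a b c).
Proof.
move=> [S1 PhiE] [S2 PsiE]; exists (S1 `|` S2)%fset => S.
rewrite fsubUset => /andP[S1S S2S] F G H; rewrite (PhiE S) // (PsiE S) //.
rewrite -big_split; apply: eq_bigr => a _; rewrite -big_split.
apply: eq_bigr => b _; rewrite -big_split; apply: eq_bigr => c _.
by rewrite mulrDr.
Qed.

Lemma trilinear_kernel0 : trilinear_kernel (fun _ _ _ => 0) (fun _ _ _ => 0).
Proof.
by exists fset0 => S _ F G H; rewrite !big1 // => *; rewrite !big1 // => *;
  rewrite !big1 // => *; rewrite mulr0.
Qed.

(** Both sides are expanded over the union of their sets; monomials outside [P] contribute nothing
    because the series vanish there. It is applied with [P] the condition of zero momentum. *)
Lemma eq_trilinear (P : T -> Prop) Phi Psi k l :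
    trilinear_kernel Phi k -> trilinear_kernel Psi l ->
    (forall a b c, P a -> P b -> P c -> k a b c = l a b c) ->
  forall F G H, (forall a, ~ P a -> F a = 0) -> (forall a, ~ P a -> G a = 0) ->
    (forall a, ~ P a -> H a = 0) -> Phi F G H = Psi F G H.
Proof.
move=> [S1 PhiE] [S2 PsiE] kl F G H F0 G0 H0.
rewrite (PhiE (S1 `|` S2)%fset) ?fsubsetUl // (PsiE (S1 `|` S2)%fset) ?fsubsetUr //.
apply: eq_bigr => a _; apply: eq_bigr => b _; apply: eq_bigr => c _.
have [Pa|/F0->] := pselect (P a); last by rewrite !mul0r.
have [Pb|/G0->] := pselect (P b); last by rewrite mulr0 !mul0r.
have [Pc|/H0->] := pselect (P c); last by rewrite mulr0 !mul0r.
by rewrite kl.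
Qed.

End Kernels.

(** * Divisors, momentum and finiteness of the bracket terms *)

Lemma finite_dvdm (m : {cmonom int}) :
  finite_set [set a : {cmonom int} | exists b, mmul a b = m].
Proof.
pose N := (mdeg m).+1.
(* A divisor of [m] is supported in [finsupp m] with exponents at most [mdeg m], so it is coded by
   one of finitely many functions into ['I_N], which [g] decodes. *)
pose g (f : {ffun finsupp m -> 'I_N}) : {cmonom int} :=
  mkcmonom [fsfun i : finsupp m => val (f i) | 0%N].
apply: (@sub_finite_set _ _ (range g)); last exact/finite_image/finite_finset.
move=> a [b abm]; have am i : (a i <= m i)%N by rewrite -abm cmM leq_addr.
have ltN i : (a i < N)%N.
  rewrite ltnS; apply: leq_trans (am i) _.
  have [mi|/fsfun_dflt->//] := boolP (i \in finsupp m).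
  by rewrite mdegE (big_fsetD1 i mi) leq_addr.
exists [ffun i : finsupp m => Ordinal (ltN (val i))] => //.
apply/eqP/cmP => i; rewrite cmE fsfun_ffun.
case: insubP => [j _ <-|im] /=; first by rewrite ffunE.
by apply/esym/eqP; have := am i; rewrite (fsfun_dflt im) leqn0.
Qed.

Definition bi_mul (m1 m2 : bi_index) : bi_index := (mmul m1.1 m2.1, mmul m1.2 m2.2).

Definition bi_gen (j : int) : bi_index := (ucm j, ucm j).

(* Truncated subtraction, like the underlying [divcm]. *)
Definition bi_div (m1 m2 : bi_index) : bi_index :=
  (divcm m1.1 m2.1, divcm m1.2 m2.2).

Definition bi_conj (m : bi_index) : bi_index := (m.2, m.1).

Lemma bi_mulA : associative bi_mul.
Proof. by move=> a b c; rewrite /bi_mul !mulmA. Qed.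

Lemma bi_mulC : commutative bi_mul.
Proof. by move=> a b; rewrite /bi_mul (mulmC a.1) (mulmC a.2). Qed.

Lemma mmul_injr (a : {cmonom int}) : injective (mmul^~ a).
Proof.
move=> b c bc; apply/eqP/cmP => i.
by have := congr1 (fun x : {cmonom int} => x i) bc; rewrite !cmM => /addIn.
Qed.

Lemma bi_mulIr a : injective (bi_mul^~ a).
Proof. by move=> [b1 b2] [c1 c2] [/mmul_injr-> /mmul_injr->]. Qed.

Lemma divcmK (a : {cmonom int}) k : (0 < a k)%N ->
  mmul (divcm a (ucm k)) (ucm k) = a.
Proof.
move=> ak; apply/eqP/cmP => i; rewrite cmM divcmE ucmE.
by case: eqVneq => [<-|_]; lia.
Qed.

Lemma bi_divK (x : bi_index) k : (0 < x.1 k)%N -> (0 < x.2 k)%N ->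
  bi_mul (bi_div x (bi_gen k)) (bi_gen k) = x.
Proof. by case: x => x1 x2 *; congr pair; exact: divcmK. Qed.

Lemma finite_bi_dvd (m : bi_index) :
  finite_set [set a : bi_index | exists b, bi_mul a b = m].
Proof.
apply: sub_finite_set (finite_setX (finite_dvdm m.1) (finite_dvdm m.2)).
by move=> a [b <-]; split; [exists b.1|exists b.2].
Qed.

Lemma momentumE (S : {fset int}) (m : bi_index) : (finsupp m.1 `<=` S)%fset ->
  (finsupp m.2 `<=` S)%fset ->
  momentum m = \sum_(j <- S) j * ((m.1 j)%:Z - (m.2 j)%:Z).
Proof.
move=> /fsubsetP S1 /fsubsetP S2; apply: fsbigTE => j jS.
rewrite !fsfun_dflt ?subrr ?mulr0 //.
  by apply: contra jS => /S2.
by apply: contra jS => /S1.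
Qed.

Lemma momentumM m1 m2 : momentum (bi_mul m1 m2) = momentum m1 + momentum m2.
Proof.
pose S := ((finsupp m1.1 `|` finsupp m1.2) `|` (finsupp m2.1 `|` finsupp m2.2))%fset.
rewrite !(@momentumE S); last first.
all: try by apply/fsubsetP => j; rewrite ?mdomD !inE => /orP[]->; rewrite ?orbT.
all: try by apply/fsubsetP => j; rewrite !inE => ->; rewrite ?orbT.
rewrite -big_split; apply: eq_bigr => j _; rewrite /= !cmM !PoszD; ring.
Qed.

Lemma momentum_ucm j : momentum (ucm j, mone) = j.
Proof.
rewrite (@momentumE [fset j]%fset) /= ?mdom1 ?fsub0set ?mdomU //.
by rewrite big_seq_fset1 ucmE cm1 eqxx subr0 mulr1.
Qed.

Lemma momentum_conj m : momentum (bi_conj m) = - momentum m.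
Proof.
pose S := (finsupp m.1 `|` finsupp m.2)%fset.
rewrite !(@momentumE S) ?fsubsetUl ?fsubsetUr // -sumrN.
by apply: eq_bigr => j _ /=; ring.
Qed.

(** Conjugation negates the momentum but fixes [bi_gen j]. *)
Lemma momentum_gen j : momentum (bi_gen j) = 0.
Proof.
have : momentum (bi_gen j) = - momentum (bi_gen j) := momentum_conj (bi_gen j).
lia.
Qed.

Lemma bracket_termsP m t : bracket_terms m t <->
  [/\ momentum t.1.1 = 0, momentum t.1.2 = 0, bracket_factor t.1.1 t.1.2 t.2 <> 0 &
      bi_mul t.1.1 t.1.2 = bi_mul m (bi_gen t.2)].
Proof.
case: t => [[m1 m2] j] /=; split=> [[? ? ? e1 e2]|[? ? ? [e1 e2]]]; split=> //.
by congr pair.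
Qed.

(* If [j] occurs in neither component of [m], then [u_j] occurs exactly once in one
   of [m1], [m2], and removing it leaves a divisor of [m] of momentum [- j]. *)
Lemma finite_bracket_terms m : finite_set (bracket_terms m).
Proof.
pose D := [set a : bi_index | exists b, bi_mul a b = m].
(* Candidates for [j]: a variable of [m], or minus the momentum of a divisor of [m]. *)
pose J := [set` (finsupp m.1 `|` finsupp m.2)%fset] `|` (fun a => - momentum a) @` D.
pose B j := [set a : bi_index | exists b, bi_mul a b = bi_mul m (bi_gen j)].
pose X := \bigcup_(j in J) ((B j `*` B j) `*` [set j]).
have Xfin : finite_set X.
  apply: bigcup_finite => [|j _]; last first.
    by apply: finite_setX => //; apply: finite_setX; exact: finite_bi_dvd.
  by rewrite finite_setU; split; [exact: finite_fset|exact/finite_image/finite_bi_dvd].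
apply: sub_finite_set Xfin => -[[m1 m2] j] /bracket_termsP[/= mom1 mom2 f0 e].
exists j => //=; last first.
  by split=> //; split; [exists m2|exists m1; rewrite bi_mulC].
have [jm|] := boolP (j \in (finsupp m.1 `|` finsupp m.2)%fset); first by left.
rewrite inE negb_or => /andP[/fsfun_dflt jm1 /fsfun_dflt jm2]; right.
(* Here [a] supplies [u_j] and [b] supplies [ubar_j]: removing [u_j] from [a] leaves the required
   divisor, with cofactor [b] stripped of [ubar_j]. *)
have aux a b : bi_mul a b = bi_mul m (bi_gen j) -> momentum a = 0 ->
    a.1 j = 1%N -> b.2 j = 1%N -> exists2 c, D c & - momentum c = j.
  case: a b => a1 a2 [b1 b2] /= abE a0 a1j b2j.
  have a1E : mmul (divcm a1 (ucm j)) (ucm j) = a1 by rewrite divcmK ?a1j.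
  have b2E : mmul (divcm b2 (ucm j)) (ucm j) = b2 by rewrite divcmK ?b2j.
  exists (divcm a1 (ucm j), a2); last first.
    have aE : (a1, a2) = bi_mul (divcm a1 (ucm j), a2) (ucm j, mone).
      by rewrite /bi_mul /= mulm1 a1E.
    by move: a0; rewrite aE momentumM momentum_ucm; lia.
  exists (b1, divcm b2 (ucm j)); apply: (@bi_mulIr (bi_gen j)); rewrite -abE /bi_mul /=.
  by rewrite -mulmA (mulmC b1) mulmA a1E -mulmA b2E.
have [e1 e2] : mmul m1.1 m2.1 = mmul m.1 (ucm j) /\
    mmul m1.2 m2.2 = mmul m.2 (ucm j).
  by case: e.
have := congr1 (fun x : {cmonom int} => x j) e1.
have := congr1 (fun x : {cmonom int} => x j) e2.
rewrite !cmM jm1 jm2 ucmE eqxx => s2 s1; move: f0; rewrite /bracket_factor /=.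
(* As [j] is absent from [m], the product contains [u_j] and [ubar_j] once each. If one factor
   supplied both, the bracket factor would vanish, so they come from different factors. *)
have [m11|m11] : m1.1 j = 1%N \/ m1.1 j = 0%N by lia.
  have [m12 _|m12] : m1.2 j = 0%N \/ m1.2 j = 1%N by lia.
    by apply: (aux m1 m2) => //; lia.
  have -> : m2.1 j = 0%N by lia.
  have -> : m2.2 j = 0%N by lia.
  by lia.
have [m12|m12 _] : m1.2 j = 0%N \/ m1.2 j = 1%N by lia.
  by rewrite m11 m12; lia.
by apply: (aux m2 m1) => //; [rewrite bi_mulC|lia].
Qed.

(** * Bracket factors and exact division *)

Definition bi_supp (a : bi_index) : {fset int} := (finsupp a.1 `|` finsupp a.2)%fset.

Definition zero_momentum (a : bi_index) : bool := momentum a == 0.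

Lemma bracket_factor_supp S a b j : (bi_supp a `<=` S)%fset -> j \notin S ->
  bracket_factor a b j = 0.
Proof.
move=> /fsubsetP aS jS; have := contra (aS j) jS.
rewrite inE negb_or => /andP[/fsfun_dflt a1 /fsfun_dflt a2].
by rewrite /bracket_factor a1 a2 !mul0r subrr.
Qed.

Lemma bracket_factorC a b j : bracket_factor b a j = - bracket_factor a b j.
Proof. by rewrite /bracket_factor; ring. Qed.

(** Exponents add under multiplication; this additivity is what becomes the Leibniz rule. *)
Lemma bracket_factorM a b c j :
  bracket_factor a (bi_mul b c) j = bracket_factor a b j + bracket_factor a c j.
Proof. by rewrite /bracket_factor /= !cmM !PoszD; ring. Qed.

(** If [u_j], or [ubar_j], were missing from both [a] and [b], each product in the factor would
    vanish. Hence truncated division by [bi_gen j] is exact wherever the factor is nonzero. *)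
Lemma bracket_factor_gt0 a b j : bracket_factor a b j != 0 ->
  (0 < (bi_mul a b).1 j)%N /\ (0 < (bi_mul a b).2 j)%N.
Proof.
rewrite /bracket_factor /= !cmM => ab0.
by split; rewrite lt0n addn_eq0; apply: contra ab0 => /andP[/eqP-> /eqP->];
  rewrite !(mul0r, mulr0) subrr.
Qed.

(** Division lowers the exponents of [u_k] and [ubar_k] by one, which yields the correction at
    [j = k]; the nonvanishing hypothesis rules out truncation. *)
Lemma bracket_factor_div a b c j k : bracket_factor b c k != 0 ->
  bracket_factor a (bi_div (bi_mul b c) (bi_gen k)) j =
  bracket_factor a b j + bracket_factor a c j - ((a.1 j)%:Z - (a.2 j)%:Z) *+ (k == j).
Proof.
move=> /bracket_factor_gt0[]; rewrite -bracket_factorM /bracket_factor.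
set x := bi_mul b c => x1 x2; rewrite /= !divcmE !ucmE.
by case: eqVneq x1 x2 => [<-|_] x1 x2;
  rewrite /= ?subn0 ?mulr0n ?mulr1n -?subzn //; ring.
Qed.

Lemma zero_momentumM a b :
  zero_momentum a -> zero_momentum b -> zero_momentum (bi_mul a b).
Proof. by rewrite /zero_momentum momentumM => /eqP-> /eqP->. Qed.

(** * The kernels of the product and of the bracket *)

Section BracketKernel.
Variable R : realType.
Local Notation C := (Rcomplex R).
Implicit Types (a b c m q : bi_index) (F G H : fseries R).

Definition mul_kernel a b m : C := (bi_mul a b == m)%:R.

(** The monomial equation is multiplied through by [bi_gen j], as in [bracket_terms], so that no
    truncated division appears. The sum over [j] has finite support since the factor vanishes off
    the variables of [a]. *)
Definition br_kernel a b m : C :=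
  ('i%C : C) * (zero_momentum a && zero_momentum b)%:R *
  \sum_(j \in [set: int])
    ((bracket_factor a b j)%:~R * (bi_mul a b == bi_mul m (bi_gen j))%:R : C).

Lemma br_kernelE (S : {fset int}) a b m : (bi_supp a `<=` S)%fset ->
  br_kernel a b m = ('i%C : C) * (zero_momentum a && zero_momentum b)%:R *
    \sum_(j <- S)
      ((bracket_factor a b j)%:~R * (bi_mul a b == bi_mul m (bi_gen j))%:R : C).
Proof.
move=> aS; rewrite /br_kernel; congr (_ * _); apply: fsbigTE => j jS.
by rewrite (bracket_factor_supp _ aS jS) mul0r.
Qed.

Lemma has_kernel_mul : has_kernel (@series_mul R) mul_kernel.
Proof.
move=> m; pose D := [set a : bi_index | exists b, bi_mul a b = m].
have Dfin : finite_set D by exact: finite_bi_dvd.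
have DP a b : bi_mul a b = m -> a \in fset_set D /\ b \in fset_set D.
  by move=> e; rewrite !in_fset_set // !inE; split; [exists b|exists a; rewrite bi_mulC].
exists (fset_set D); split=> [a b|F G].
  by rewrite /mul_kernel; case: eqP => [/DP[-> ->]|].
under eq_bigr do rewrite fsbig_seq ?fset_uniq //.
rewrite fsbig_seq ?fset_uniq // pair_fsbig ?fset_setK //.
rewrite -(@fsbig_widen _ _ _ _ [set p | bi_mul p.1 p.2 = m]) => [|[a b]|[a b] [_ ab]].
- apply: eq_fsbigr => -[a b]; rewrite inE => e.
  by rewrite /mul_kernel (e : bi_mul a b = m) eqxx mulr1.
- by move=> /= /DP[]; rewrite !in_fset_set // !inE.
- have k0 : mul_kernel a b m = 0 by rewrite /mul_kernel; case: eqP => // /ab.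
  by rewrite /preimage /set1 /= k0 mulr0.
Qed.

(** The finite set [bracket_terms m] lies in a box with sides [S], [S], [J], and the summand
    vanishes on the rest of the box; the sum over triples thus becomes an iterated sum. *)
Lemma has_kernel_bracket : has_kernel (@series_bracket R) br_kernel.
Proof.
move=> m; have Xfin := finite_bracket_terms m; set X := bracket_terms m in Xfin *.
pose S := fset_set ((fun t => t.1.1) @` X `|` (fun t => t.1.2) @` X).
pose J := fset_set (snd @` X).
have SE : [set` S] = (fun t => t.1.1) @` X `|` (fun t => t.1.2) @` X.
  by rewrite fset_setK // finite_setU; split; exact: finite_image.
have JE : [set` J] = snd @` X by rewrite fset_setK //; exact: finite_image.
have XP a b j : X (a, b, j) -> [/\ a \in S, b \in S & j \in J].
  move=> Xt; have inS c : [set` S] c -> c \in S by [].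
  split; first by apply: inS; rewrite SE; left; exists (a, b, j).
    by apply: inS; rewrite SE; right; exists (a, b, j).
  have: [set` J] j by rewrite JE; exists (a, b, j).
  by [].
have term0 a b j : ~ X (a, b, j) -> (zero_momentum a && zero_momentum b)%:R *
    ((bracket_factor a b j)%:~R * (bi_mul a b == bi_mul m (bi_gen j))%:R) = 0 :> C.
  move=> Xt; have [/eqP a0|] := boolP (zero_momentum a); last by rewrite mul0r.
  have [/eqP b0|] := boolP (zero_momentum b); last by rewrite mul0r.
  have [->|/eqP f0] := eqVneq (bracket_factor a b j) 0; first by rewrite mul0r mulr0.
  have [e|] := eqVneq (bi_mul a b); last by rewrite !mulr0.
  by case: Xt; apply/bracket_termsP.
have kE a b : br_kernel a b m = ('i%C : C) * \sum_(j <- J)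
    ((zero_momentum a && zero_momentum b)%:R *
     ((bracket_factor a b j)%:~R * (bi_mul a b == bi_mul m (bi_gen j))%:R)).
  rewrite /br_kernel -mulrA; congr (_ * _).
  rewrite (@fsbigTE _ _ _ _ (bi_supp a `|` J)%fset) => [|j]; last first.
    rewrite inE negb_or => /andP[ja _].
    by rewrite (bracket_factor_supp _ (fsubset_refl _) ja) mul0r.
  rewrite mulr_sumr; apply/esym/big_fset_incl; first exact: fsubsetUr.
  by move=> j _ jJ; apply: term0 => /XP[_ _]; rewrite (negbTE jJ).
exists S; split=> [a b abS|F G].
  rewrite kE big1 ?mulr0 // => j _; apply: term0 => /XP[aS bS _].
  by rewrite aS bS in abS.
pose g t : C := F t.1.1 * G t.1.2 * ((zero_momentum t.1.1 && zero_momentum t.1.2)%:R *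
     ((bracket_factor t.1.1 t.1.2 t.2)%:~R *
      (bi_mul t.1.1 t.1.2 == bi_mul m (bi_gen t.2))%:R)).
transitivity (('i%C : C) * \sum_(t \in X) g t).
  congr (_ * _); apply: eq_fsbigr => t; rewrite inE => /bracket_termsP[a0 b0 _ e].
  by rewrite /g /zero_momentum a0 b0 e !eqxx mul1r mulr1.
rewrite (@fsbig_widen _ _ _ _ X (([set` S] `*` [set` S]) `*` [set` J]));
  [|by move=> [[a b] j] /XP[]|by move=> [[a b] j] [_ /term0]; rewrite /g /= => ->;
                                rewrite mulr0].
rewrite -(pair_fsbig _ (fun p j => g (p, j))) //; last exact: finite_setX.
rewrite -(pair_fsbig _ (fun a b => \sum_(j \in [set` J]) g (a, b, j))) //.
rewrite -fsbig_seq ?fset_uniq // mulr_sumr; apply: eq_bigr => a _.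
rewrite -fsbig_seq ?fset_uniq // mulr_sumr; apply: eq_bigr => b _.
rewrite -fsbig_seq ?fset_uniq // kE mulrCA; congr (_ * _).
by rewrite [RHS]mulr_sumr.
Qed.

End BracketKernel.

(* By [bracket_factor_div], the coefficient of [a * b * c / (e_k e_j)] in the nested
   bracket of the monomials [a], [b], [c], up to the sign [-1 = 'i ^+ 2]. *)
Definition nested_factor a b c k j : int :=
  bracket_factor b c k * (bracket_factor a b j + bracket_factor a c j -
                          ((a.1 j)%:Z - (a.2 j)%:Z) *+ (k == j)).

(** Write x, y, z for the factors of [(a, b)], [(b, c)], [(c, a)]. The main parts sum cyclically to
    y_k (x_j - z_j) + z_k (y_j - x_j) + x_k (z_j - y_j), antisymmetric in [k] and [j]. The
    corrections occur only for [k = j] and cancel cyclically, as in a determinant with two equal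
    rows. *)
Lemma nested_factor_jacobi a b c k j :
  nested_factor a b c k j + nested_factor b c a k j + nested_factor c a b k j =
  - (nested_factor a b c j k + nested_factor b c a j k + nested_factor c a b j k).
Proof.
rewrite /nested_factor /bracket_factor (eq_sym j).
by case: eqVneq => [->|_]; rewrite ?mulr0n ?mulr1n; ring.
Qed.

(** Exchanging the two sums shows that the total is its own opposite. *)
Lemma sum_antisymmetric (D : idomainType) (S : {fset int})
    (A1 A2 A3 : int -> int -> int)
    (e : int -> int -> D) : (2%:R : D) != 0 ->
    (forall k j, A1 k j + A2 k j + A3 k j = - (A1 j k + A2 j k + A3 j k)) ->
    (forall k j, e k j = e j k) ->
  \sum_(k <- S) \sum_(j <- S) (A1 k j)%:~R * e k j +
  \sum_(k <- S) \sum_(j <- S) (A2 k j)%:~R * e k j +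
  \sum_(k <- S) \sum_(j <- S) (A3 k j)%:~R * e k j = 0.
Proof.
move=> D2 AN eC; pose A k j := A1 k j + A2 k j + A3 k j.
transitivity (\sum_(k <- S) \sum_(j <- S) (A k j)%:~R * e k j).
  rewrite -!big_split; apply: eq_bigr => k _; rewrite -!big_split.
  by apply: eq_bigr => j _; rewrite /= -!mulrDl -!intrD.
set s := (X in X = 0); have sN : s = - s.
  rewrite {1}/s exchange_big -sumrN; apply: eq_bigr => k _.
  by rewrite -sumrN; apply: eq_bigr => j _; rewrite /A AN intrN mulNr eC.
have /eqP : s *+ 2 = 0 by rewrite mulr2n {1}sN addNr.
by rewrite -mulr_natl mulf_eq0 (negbTE D2) => /eqP.
Qed.

(** * The Leibniz and Jacobi identities on monomials *)

Section KernelIdentities.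
Variable R : realType.
Local Notation C := (Rcomplex R).
Implicit Types (a b c m q : bi_index) (F G H : fseries R).

Lemma bi_mul_gen_eq b c q k : bracket_factor b c k != 0 ->
  (bi_mul b c == bi_mul q (bi_gen k)) = (q == bi_div (bi_mul b c) (bi_gen k)).
Proof.
move=> /bracket_factor_gt0[x1 x2]; have e := bi_divK x1 x2.
by rewrite -{1}e (inj_eq (@bi_mulIr _)) eq_sym.
Qed.

(** Each [k] with nonzero factor selects a single [q], the exact quotient of [bi_mul b c] by
    [bi_gen k]. Where the factor is zero the quotient may be truncated, but its coefficient kills
    the term. *)
Lemma fsum_br_kernel (S : {fset int}) (h : bi_index -> C) b c :
    (bi_supp b `<=` S)%fset ->
  \sum_(q \in [set: bi_index]) h q * br_kernel R b c q =
  ('i%C : C) * (zero_momentum b && zero_momentum c)%:R *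
  \sum_(k <- S) (bracket_factor b c k)%:~R * h (bi_div (bi_mul b c) (bi_gen k)).
Proof.
move=> bS; pose d k := bi_div (bi_mul b c) (bi_gen k).
pose A := [fset d k | k in S]%fset.
rewrite (@fsbigTE _ _ _ _ A) => [|q qA]; last first.
  rewrite (br_kernelE _ _ _ bS) big_seq big1 ?mulr0 // => k kS.
  have [->|f0] := eqVneq (bracket_factor b c k) 0; first by rewrite mul0r.
  rewrite bi_mul_gen_eq //; case: eqP => [qd|]; last by rewrite mulr0.
  by case/negP: qA; rewrite qd; apply/imfsetP; exists k.
under eq_bigr do rewrite (br_kernelE _ _ _ bS) mulrCA mulr_sumr.
rewrite -mulr_sumr exchange_big; congr (_ * _).
apply: eq_big_seq => k kS /=.
have [->|f0] := eqVneq (bracket_factor b c k) 0.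
  by rewrite mul0r big1 // => q _; rewrite mul0r mulr0.
have dA : d k \in A by apply/imfsetP; exists k.
rewrite (big_fsetD1 _ dA) /= big_seq big1 => [|q]; last first.
  by rewrite !inE bi_mul_gen_eq // => /andP[/negbTE-> _]; rewrite !mulr0.
by rewrite bi_mul_gen_eq // eqxx mulr1 addr0 mulrC.
Qed.

Lemma fsum_mul_kernel (h : bi_index -> C) b c :
  \sum_(q \in [set: bi_index]) h q * mul_kernel R b c q = h (bi_mul b c).
Proof.
rewrite (@fsbigTE _ _ _ _ [fset bi_mul b c]%fset) => [|q].
  by rewrite big_seq_fset1 /mul_kernel eqxx mulr1.
by rewrite inE /mul_kernel eq_sym => /negbTE->; rewrite mulr0.
Qed.

Lemma kcomp_mul_mul a b c m :
  kcomp (@mul_kernel R) (@mul_kernel R) a b c m = (bi_mul a (bi_mul b c) == m)%:R.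
Proof. exact: fsum_mul_kernel. Qed.

Lemma kcomp_br_mul a b c m :
  kcomp (@br_kernel R) (@mul_kernel R) a b c m = br_kernel R a (bi_mul b c) m.
Proof. exact: fsum_mul_kernel. Qed.

Lemma kcomp_mul_br (S : {fset int}) a b c m : (bi_supp b `<=` S)%fset ->
  kcomp (@mul_kernel R) (@br_kernel R) a b c m =
  ('i%C : C) * (zero_momentum b && zero_momentum c)%:R *
  \sum_(k <- S) ((bracket_factor b c k)%:~R *
     (bi_mul a (bi_mul b c) == bi_mul m (bi_gen k))%:R : C).
Proof.
move=> bS; rewrite /kcomp (fsum_br_kernel _ _ bS); congr (_ * _).
apply: eq_bigr => k _; rewrite /mul_kernel.
have [->|/bracket_factor_gt0[x1 x2]] := eqVneq (bracket_factor b c k) 0.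
  by rewrite !mul0r.
by rewrite -{2}(bi_divK x1 x2) bi_mulA (inj_eq (@bi_mulIr _)).
Qed.

(** The right side collects the kernels of [H {F, G}] and [G {F, H}], hence the permuted arguments.
    All three kernels test the same product of [a], [b], [c], and the factors agree by
    [bracket_factorM]. *)
Lemma kernel_leibniz a b c m :
    zero_momentum a -> zero_momentum b -> zero_momentum c ->
  kcomp (@br_kernel R) (@mul_kernel R) a b c m =
  kcomp (@mul_kernel R) (@br_kernel R) c a b m +
  kcomp (@mul_kernel R) (@br_kernel R) b a c m.
Proof.
move=> a0 b0 c0; rewrite kcomp_br_mul !(kcomp_mul_br _ _ _ (fsubset_refl (bi_supp a))).
rewrite (br_kernelE _ _ _ (fsubset_refl (bi_supp a))).
rewrite a0 b0 c0 zero_momentumM //= -mulrDr -big_split; congr (_ * _).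
apply: eq_bigr => k _ /=; rewrite bracket_factorM rmorphD mulrDl /=.
have -> : bi_mul c (bi_mul a b) = bi_mul a (bi_mul b c) by rewrite bi_mulC bi_mulA.
by have -> : bi_mul b (bi_mul a c) = bi_mul a (bi_mul b c)
  by rewrite bi_mulA (bi_mulC b) bi_mulA.
Qed.

Lemma kcomp_br_br (S : {fset int}) a b c m :
  zero_momentum a -> zero_momentum b -> zero_momentum c ->
  (bi_supp a `<=` S)%fset -> (bi_supp b `<=` S)%fset ->
  kcomp (@br_kernel R) (@br_kernel R) a b c m =
  - \sum_(k <- S) \sum_(j <- S) ((nested_factor a b c k j)%:~R *
     (bi_mul a (bi_mul b c) == bi_mul m (bi_mul (bi_gen k) (bi_gen j)))%:R : C).
Proof.
move=> a0 b0 c0 aS bS; rewrite /kcomp (fsum_br_kernel _ _ bS) b0 c0 mulr1.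
rewrite mulr_sumr -sumrN; apply: eq_bigr => k _.
have [f0|f0] := eqVneq (bracket_factor b c k) 0.
  rewrite f0 !mul0r mulr0 big1 ?oppr0 // => j _.
  by rewrite /nested_factor f0 !mul0r.
have [x1 x2] := bracket_factor_gt0 f0; have e := bi_divK x1 x2.
set d := bi_div _ _ in e *.
(* The inner bracket keeps momentum zero, since [bi_gen k] has none to remove. *)
have d0 : zero_momentum d.
  have := zero_momentumM b0 c0; rewrite -e /zero_momentum momentumM momentum_gen.
  by rewrite addr0.
rewrite (br_kernelE _ _ _ aS) a0 d0 mulr1 !mulr_sumr -sumrN; apply: eq_bigr => j _.
rewrite -e bi_mulA [bi_mul (bi_gen k) _]bi_mulC bi_mulA (inj_eq (@bi_mulIr _)).
rewrite /nested_factor -bracket_factor_div // -/d rmorphM /=.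
have ii : ('i%C : C) * 'i%C = -1 by have := sqr_i R; rewrite expr2.
have -> x y z : ('i%C : C) * (x * ('i%C * (y * z))) = 'i%C * 'i%C * (x * y * z).
  by move=> *; ring.
by rewrite ii mulN1r.
Qed.

(** The three nested kernels share one indicator, symmetric in [k] and [j]; only the nested factors
    differ, and their cyclic sum is antisymmetric. *)
Lemma kernel_jacobi a b c m :
    zero_momentum a -> zero_momentum b -> zero_momentum c ->
  kcomp (@br_kernel R) (@br_kernel R) a b c m +
  kcomp (@br_kernel R) (@br_kernel R) b c a m +
  kcomp (@br_kernel R) (@br_kernel R) c a b m = 0.
Proof.
move=> a0 b0 c0; pose S := (bi_supp a `|` bi_supp b `|` bi_supp c)%fset.
have [aS bS cS] : [/\ bi_supp a `<=` S, bi_supp b `<=` S & bi_supp c `<=` S]%fset.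
  rewrite /S; move: (bi_supp a) (bi_supp b) (bi_supp c) => A B D.
  by split; apply/fsubsetP => x xS; rewrite !inE xS ?orbT.
rewrite (kcomp_br_br _ a0 b0 c0 aS bS) (kcomp_br_br _ b0 c0 a0 bS cS).
rewrite (kcomp_br_br _ c0 a0 b0 cS aS).
rewrite -!opprD.
have -> : bi_mul b (bi_mul c a) = bi_mul a (bi_mul b c)
  by rewrite [RHS]bi_mulC bi_mulA.
have -> : bi_mul c (bi_mul a b) = bi_mul a (bi_mul b c) by rewrite bi_mulC bi_mulA.
rewrite (@sum_antisymmetric C S (nested_factor a b c) (nested_factor b c a)
  (nested_factor c a b) (fun k j => (_ == bi_mul m (bi_mul (bi_gen k) (bi_gen j)))%:R)).
- exact: oppr0.
- by rewrite (@pnatr_eq0 R[i]).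
- exact: nested_factor_jacobi.
- by move=> k j; rewrite (bi_mulC (bi_gen k)).
Qed.

End KernelIdentities.

(** * Degree, conjugation and closure of the space of series *)

Definition bi_deg (m : bi_index) : nat := (mdeg m.1 + mdeg m.2)%N.

Lemma bi_degM a b : bi_deg (bi_mul a b) = (bi_deg a + bi_deg b)%N.
Proof. by rewrite /bi_deg !mdegM addnACA. Qed.

Lemma bi_deg_gen j : bi_deg (bi_gen j) = 2%N.
Proof. by rewrite /bi_deg !mdegU. Qed.

Lemma bi_conjM a b : bi_conj (bi_mul a b) = bi_mul (bi_conj a) (bi_conj b).
Proof. by []. Qed.

Lemma bi_conjK : involutive bi_conj.
Proof. by case. Qed.

Section CalF.
Variable R : realType.
Local Notation C := (Rcomplex R).
Implicit Types (a b c m q : bi_index) (F G H : fseries R).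

Lemma conjc_fsum (T : choiceType) (X : set T) (g : T -> C) : finite_set X ->
  conjc (\sum_(t \in X) g t) = \sum_(t \in X) (conjc (g t) : C).
Proof. by move=> Xfin; rewrite !fsbig_finite // (raddf_sum (@conjc R)). Qed.

Lemma conjcM (x y : C) : conjc (x * y) = (conjc x : C) * conjc y.
Proof. exact: (rmorphM (@conjc R)). Qed.

Lemma conjc_int n : conjc (n%:~R : C) = n%:~R.
Proof. exact: (rmorph_int (@conjc R)). Qed.

Lemma finite_factorizations m :
  finite_set [set p : bi_index * bi_index | bi_mul p.1 p.2 = m].
Proof.
apply: sub_finite_set (finite_setX (finite_bi_dvd m) (finite_bi_dvd m)).
by move=> [a b] /= e; split; [exists b|exists a; rewrite bi_mulC].
Qed.

Lemma calF_conj F m : in_calF F -> F (bi_conj m) = conjc (F m).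
Proof. by case: m => a b [_ FC _]; rewrite /bi_conj FC. Qed.

Lemma series_mul_conj F G m : in_calF F -> in_calF G ->
  series_mul F G (bi_conj m) = conjc (series_mul F G m).
Proof.
move=> FF GF; rewrite /series_mul conjc_fsum; last exact: finite_factorizations.
rewrite (@reindex_fsbig _ _ _ _ _ (fun p => (bi_conj p.1, bi_conj p.2))
  [set p : bi_index * bi_index | bi_mul p.1 p.2 = m]); last first.
  split=> [[a b] /= e|[[a1 a2] [b1 b2]] [[c1 c2] [d1 d2]] _ _|[a b] /= e].
  - by rewrite -[LHS]bi_conjM e.
  - by move=> [] -> -> -> ->.
  - by exists (bi_conj a, bi_conj b);
      rewrite ?bi_conjK //= -bi_conjM [bi_mul a b]e bi_conjK.
by apply: eq_fsbigr => -[a b] _; rewrite !calF_conj // conjcM.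
Qed.

Lemma bracket_terms_conj m :
  set_bij (bracket_terms m) (bracket_terms (bi_conj m))
    (fun t => (bi_conj t.1.1, bi_conj t.1.2, t.2)).
Proof.
have conjP k t : bracket_terms k t ->
    bracket_terms (bi_conj k) (bi_conj t.1.1, bi_conj t.1.2, t.2).
  move=> /bracket_termsP[a0 b0 f0 e]; apply/bracket_termsP; split=> /=.
  - by rewrite momentum_conj a0 oppr0.
  - by rewrite momentum_conj b0 oppr0.
  - move=> f0'; apply: f0; apply: oppr_inj; rewrite oppr0 -[RHS]f0'.
    by rewrite /bracket_factor /bi_conj /=; ring.
  - by rewrite -[LHS]bi_conjM e.
split=> [t /conjP //|[[[a1 a2] [b1 b2]] j] [[[c1 c2] [d1 d2]] k] _ _|
         [[a b] j] /conjP h].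
  by move=> [] -> -> -> -> ->.
exists (bi_conj a, bi_conj b, j); last by rewrite /= !bi_conjK.
by rewrite -[m]bi_conjK.
Qed.

(** Conjugation reverses the sign of ['i] and, by exchanging the components of each index, that of
    the bracket factor; the two signs cancel. *)
Lemma series_bracket_conj F G m : in_calF F -> in_calF G ->
  series_bracket F G (bi_conj m) = conjc (series_bracket F G m).
Proof.
move=> FF GF; rewrite /series_bracket conjcM.
rewrite conjc_fsum; last exact: finite_bracket_terms.
rewrite (@reindex_fsbig _ _ _ _ _ _ _ _ _ (bracket_terms_conj m)).
have -> : conjc 'i%C = - 'i%C :> C by apply/eqP; rewrite eq_complex /= oppr0 !eqxx.
rewrite mulNr -mulrN !fsbig_finite; try exact: finite_bracket_terms.
rewrite -sumrN; congr (_ * _); apply: eq_bigr => -[[a b] j] _ /=.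
rewrite !calF_conj // 2!conjcM conjc_int.
have -> : bracket_factor (bi_conj a) (bi_conj b) j = - bracket_factor a b j.
  by rewrite /bracket_factor /=; ring.
by rewrite intrN mulrN.
Qed.

(** In every term the degrees of the two factors add up to [bi_deg m + 2], so they cannot reach
    [d1 + 2] and [d2 + 2] at once. *)
Lemma series_bracket_ge d1 d2 F G m :
  (forall a, (bi_deg a < d1 + 2)%N -> F a = 0) ->
  (forall a, (bi_deg a < d2 + 2)%N -> G a = 0) ->
  (bi_deg m < d1 + d2 + 2)%N -> series_bracket F G m = 0.
Proof.
move=> F0 G0 m_lt; rewrite /series_bracket fsbig1 ?mulr0 // => t.
move=> /bracket_termsP[_ _ _ /(congr1 bi_deg)]; rewrite !bi_degM bi_deg_gen => e.
have [/F0->|Fge] := ltnP (bi_deg t.1.1) (d1 + 2); first by rewrite !mul0r.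
rewrite G0 ?mulr0 ?mul0r //; move: e Fge m_lt; clear.
by move: (bi_deg t.1.1) (bi_deg t.1.2) (bi_deg m) => x y z; lia.
Qed.

Lemma series_mul_eq0 F G m :
  (forall a b, bi_mul a b = m -> F a = 0 \/ G b = 0) -> series_mul F G m = 0.
Proof.
move=> FG0; apply: fsbig1 => -[a b] /FG0[]/= ->; first by rewrite mul0r.
by rewrite mulr0.
Qed.

(** The normalization removes degree 0 and the two monomials of degree one with [j = 0]; the others
    of degree one have momentum [j] or [- j], hence nonzero. *)
Lemma calF_deg_lt2 F m : in_calF F -> (bi_deg m < 2)%N -> F m = 0.
Proof.
case: m => a b [[F00 F10 F01] _ Fm] m_lt.
have deg1 (c : {cmonom int}) : mdeg c = 1%N -> exists j, c = ucm j.
  move=> c1; have /fset0Pn[j jc] : finsupp c != fset0.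
    by apply: contra_eq_neq c1 => c0; rewrite mdegE c0 big_seq_fset0.
  have cj : (0 < c j)%N by rewrite lt0n cmE_neq0.
  exists j; rewrite -[LHS](divcmK cj); rewrite -[RHS]mul1m; congr mmul.
  by apply: mdeg_eq0I; move: c1; rewrite -{1}(divcmK cj) mdegM mdegU; lia.
have [a0|a1] : mdeg a = 0%N \/ mdeg a = 1%N by rewrite /bi_deg /= in m_lt; lia.
  have [b0|b1] : mdeg b = 0%N \/ mdeg b = 1%N by rewrite /bi_deg /= in m_lt; lia.
    by rewrite (mdeg_eq0I a0) (mdeg_eq0I b0).
  rewrite (mdeg_eq0I a0); have [j ->] := deg1 _ b1.
  have [->//|/eqP j0] := eqVneq j 0; apply: Fm.
  by rewrite -[(mone, ucm j)]/(bi_conj (ucm j, mone)) momentum_conj momentum_ucm; lia.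
have b0 : mdeg b = 0%N by rewrite /bi_deg /= in m_lt; lia.
rewrite (mdeg_eq0I b0); have [j ->] := deg1 _ a1.
by have [->//|/eqP j0] := eqVneq j 0; apply: Fm; rewrite momentum_ucm.
Qed.

Lemma in_calFI F : (forall m, (bi_deg m < 2)%N -> F m = 0) ->
  (forall m, F (bi_conj m) = conjc (F m)) ->
  (forall m, momentum m <> 0 -> F m = 0) -> in_calF F.
Proof.
move=> Fdeg FC Fm; split=> // [|a b]; last exact: (FC (b, a)).
by split; apply: Fdeg; rewrite /bi_deg /= ?mdegU ?mdeg1.
Qed.

Lemma in_calF_mul F G : in_calF F -> in_calF G -> in_calF (series_mul F G).
Proof.
move=> FF GF; apply: in_calFI => [m m_lt|m|m m0]; last 1 first.
- apply: series_mul_eq0 => a b abm; have [_ _ F0] := FF; have [_ _ G0] := GF.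
  have [a0|/F0] := pselect (momentum a = 0); last by left.
  by right; apply: G0 => b0; apply: m0; rewrite -abm momentumM a0 b0.
- apply: series_mul_eq0 => a b abm; left; apply: calF_deg_lt2 => //.
  by move: m_lt; rewrite -abm bi_degM; lia.
- exact: series_mul_conj.
Qed.

Lemma in_calF_bracket F G : in_calF F -> in_calF G -> in_calF (series_bracket F G).
Proof.
move=> FF GF; apply: in_calFI => [m m_lt|m|m m0]; last 1 first.
- rewrite /series_bracket fsbig1 ?mulr0 // => t /bracket_termsP[a0 b0 _].
  move=> /(congr1 momentum); rewrite !momentumM a0 b0 momentum_gen !addr0 => m0'.
  by case: m0; rewrite -m0'.
(* This is the filtration bound with both indices zero, as members of the space vanish below degree
   2. *)
- by apply: (@series_bracket_ge 0 0) m_lt => a; apply: calF_deg_lt2.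
- exact: series_bracket_conj.
Qed.

(** The finite set of the kernel does not depend on the series, so all three evaluations expand over
    the same [S]. *)
Lemma has_kernel_linearr (op : fseries R -> fseries R -> fseries R) K F :
  has_kernel op K -> linear (op F).
Proof.
move=> /has_kernel_sub hK x G H; apply/funext => m; have [S {}hK] := hK m.
have E (G' H' : fseries R) : (x *: G' + H') m = x *: G' m + H' m by [].
have {}hK G' := hK _ (fsubset_refl S) F G'.
rewrite E !hK scaler_sumr -big_split; apply: eq_bigr => a _.
rewrite scaler_sumr -big_split; apply: eq_bigr => b _ /=.
have -> : (x *: G + H) b = x *: G b + H b by [].
by rewrite mulrDr mulrDl [F a * (_ *: _)]mulrC -!scalerAl [G b * F a]mulrC.
Qed.

End CalF.

(** Meant for [e = 1] with the product and [e = -1] with the bracket. *)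
Lemma linear_swap (R : pzRingType) (V : lmodType R) (op : V -> V -> V) e :
  (forall x y, op x y = e *: op y x) -> (forall k : R, k * e = e * k) ->
  (forall x, linear (op x)) -> forall y, linear (op^~ y).
Proof.
move=> opC eC opl y k u v; rewrite !(opC _ y) opl scalerDr.
by rewrite !scalerA eC.
Qed.

(** * The product and the bracket on [calF], and their laws *)

Section Ops.
Variable R : realType.
Local Notation C := (Rcomplex R).
Implicit Types F G H : calF R.

Fact calF_mul_subproof F G : series_mul F G \in @calF_pred R.
Proof.
by apply/asboolP/in_calF_mul; exact/asboolP/calF_valP.
Qed.

Fact calF_bracket_subproof F G : series_bracket F G \in @calF_pred R.
Proof.
by apply/asboolP/in_calF_bracket; exact/asboolP/calF_valP.
Qed.

Definition calF_mul F G := CalF (calF_mul_subproof F G).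
Definition calF_bracket F G := CalF (calF_bracket_subproof F G).

Lemma calF_in F : in_calF F.
Proof. exact/asboolP/calF_valP. Qed.

Lemma calF_eqP F G : (forall m, F m = G m) -> F = G.
Proof. by move=> FG; apply/val_inj/funext. Qed.

Lemma calFD F G m : (F + G) m = F m + G m.
Proof. by []. Qed.

Lemma calFZ (x : R) F m : (x *: F) m = x *: F m.
Proof. by []. Qed.

Lemma zero_momentum_supp F a : ~ zero_momentum a -> calF_val F a = 0.
Proof. by move=> a0; have [_ _ ->//] := calF_in F; apply/eqP/negP. Qed.

Lemma calF_mulC : commutative calF_mul.
Proof.
move=> F G; apply: calF_eqP => m.
rewrite -[RHS]mul1r; apply: (has_kernelC (@has_kernel_mul R)) => a b {}m.
by rewrite mul1r /mul_kernel bi_mulC.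
Qed.

Lemma calF_bracketC F G : calF_bracket F G = - calF_bracket G F.
Proof.
apply: calF_eqP => m; rewrite -[RHS]mulN1r.
apply: (has_kernelC (@has_kernel_bracket R)) => a b {}m.
rewrite mulN1r.
pose S := (bi_supp a `|` bi_supp b)%fset.
rewrite (@br_kernelE _ S) ?fsubsetUl // (@br_kernelE _ S) ?fsubsetUr //.
rewrite andbC -mulrN -sumrN; congr (_ * _); apply: eq_bigr => j _.
by rewrite bracket_factorC bi_mulC intrN mulNr.
Qed.

Lemma calF_mul_bilinear : bilinear_op calF_mul.
Proof.
have lin F : linear (calF_mul F).
  move=> x G H; apply: calF_eqP => m.
  exact: (congr1 (fun f => f m) (has_kernel_linearr F (@has_kernel_mul R) x G H)).
split=> //; apply: (@linear_swap _ _ _ 1) => // [x y|k].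
  by rewrite scale1r calF_mulC.
by rewrite mul1r mulr1.
Qed.

Lemma calF_bracket_bilinear : bilinear_op calF_bracket.
Proof.
have lin F : linear (calF_bracket F).
  move=> x G H; apply: calF_eqP => m.
  exact: (congr1 (fun f => f m) (has_kernel_linearr F (@has_kernel_bracket R) x G H)).
split=> //; apply: (@linear_swap _ _ _ (-1)) => // [x y|k].
  by rewrite scaleN1r calF_bracketC.
by rewrite mulN1r mulrN1.
Qed.

Lemma calF_mulA : associative calF_mul.
Proof.
(* With the right side commuted to [H (F G)], both sides have the same nested shape, the second
   being two rotations of the first. *)
move=> F G H; rewrite [RHS]calF_mulC; apply: calF_eqP => m.
have hK := kernel_comp m (@has_kernel_mul R) (@has_kernel_mul R).
apply: (eq_trilinear (P := zero_momentum) hK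
  (trilinear_kernel_rot (trilinear_kernel_rot hK))); try exact: zero_momentum_supp.
move=> a b c _ _ _ /=; rewrite !kcomp_mul_mul bi_mulC -bi_mulA.
by rewrite bi_mulC -bi_mulA bi_mulC -bi_mulA.
Qed.

Lemma calF_jacobi F G H : calF_bracket F (calF_bracket G H) +
  calF_bracket G (calF_bracket H F) + calF_bracket H (calF_bracket F G) = 0.
Proof.
apply: calF_eqP => m; rewrite 2!calFD.
have hK := kernel_comp m (@has_kernel_bracket R) (@has_kernel_bracket R).
have hK1 := trilinear_kernel_rot hK; have hK2 := trilinear_kernel_rot hK1.
apply: (eq_trilinear (P := zero_momentum)
  (trilinear_kernelD (trilinear_kernelD hK hK1) hK2) (@trilinear_kernel0 _ C));
  try exact: zero_momentum_supp.
by move=> a b c a0 b0 c0; apply: kernel_jacobi.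
Qed.

Lemma calF_leibniz F G H : calF_bracket F (calF_mul G H) =
  calF_mul (calF_bracket F G) H + calF_mul G (calF_bracket F H).
Proof.
(* Commuting one product gives [H {F, G} + G {F, H}], a double rotation and a swap of a single
   nested expression. *)
rewrite [calF_mul (calF_bracket F G) H]calF_mulC; apply: calF_eqP => m; rewrite calFD.
have hL := kernel_comp m (@has_kernel_bracket R) (@has_kernel_mul R).
have hR := kernel_comp m (@has_kernel_mul R) (@has_kernel_bracket R).
apply: (eq_trilinear (P := zero_momentum) hL
  (trilinear_kernelD (trilinear_kernel_rot (trilinear_kernel_rot hR))
                     (trilinear_kernel_swap hR))); try exact: zero_momentum_supp.
by move=> a b c a0 b0 c0; apply: kernel_leibniz.
Qed.

Lemma calF_lie : is_lie_bracket calF_bracket.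
Proof.
split=> [|F|]; [exact: calF_bracket_bilinear| |exact: calF_jacobi].
(* Antisymmetry makes twice the bracket zero, and 2 is a nonzero scalar. *)
have /eqP := calF_bracketC F F; rewrite -addr_eq0 -mulr2n -scaler_nat.
by rewrite scaler_eq0 pnatr_eq0 => /eqP.
Qed.

End Ops.

Theorem proposition2p5 (R : realType) :
  (forall m : bi_index, finite_set (bracket_terms m)) /\
  exists mul br : calF R -> calF R -> calF R,
    [/\ forall F G : calF R,
          calF_val (mul F G) = series_mul (calF_val F) (calF_val G),
        forall F G : calF R,
          calF_val (br F G) = series_bracket (calF_val F) (calF_val G),
        is_poisson_algebra mul br &
        is_filtered_lie_algebra br (@calF_ge R)].
Proof.
split; first exact: finite_bracket_terms.
exists (@calF_mul R), (@calF_bracket R); split=> //.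
  split; [exact: calF_mul_bilinear|exact: calF_mulA|exact: calF_mulC|
          exact: calF_lie|exact: calF_leibniz].
split; first exact: calF_lie.
- move=> d; split=> [|x F G]; rewrite !inE // => F0 G0 a b ab.
  by rewrite calFD calFZ F0 // G0 // scaler0 addr0.
(* Level 0 is the whole space: degree below [0 + 2] already forces a zero coefficient. *)
- rewrite -subTset => F _ a b ab; exact: (calF_deg_lt2 (m := (a, b)) (calF_in F)).
- by move=> d F F0 a b ab; apply: F0; lia.
- move=> d1 d2 F G F0 G0 a b ab.
  by apply: (@series_bracket_ge _ d1 d2 F G (a, b)) => // -[c e]; [exact: F0|exact: G0].
Qed.
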